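(* Let $G$ be a free abelian group (not necessarily of finite rank). Then every non-empty finite subset $S$ of $G$ is a minimal complement to some subset of $G$; that is, there exists a non-empty subset $W\subseteq G$ such that $S+W=G$ and $(S\setminus\{s\})+W\neq G$ for every $s\in S$.
   Context: For non-empty subsets $A,B$ of an abelian group $G$, $A$ is a complement of $B$ if $A+B=G$, and $A$ is a minimal complement of $B$ if $A+B=G$ and $(A\setminus\{a\})+B\neq G$ for every $a\in A$. *)

(* Defs.v *)
From HB Require Import structures.
From mathcomp Require Import all_boot all_order all_algebra.
From mathcomp Require Import boolp classical_sets functions cardinality.
From mathcomp Require Import freeg.

Set Implicit Arguments.
Unset Strict Implicit.
Unset Printing Implicit Defensive.

Import GRing.Theory.
Local Open Scope classical_set_scope.
Local Open Scope ring_scope.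

(* [{freeg K}] consists of the finitely supported formal integer
   combinations of elements of K, and K may be empty or infinite: every
   rank, finite or not, is covered. *)
Definition free_abelian (G : zmodType) : Prop :=
  exists (K : choiceType) (f : {additive {freeg K} -> G}), bijective f.

Definition sumset (G : zmodType) (A B : set G) : set G :=
  [set a + b | a in A & b in B].

(* The next two relations are meant for non-empty A and B; non-emptiness is
   a separate hypothesis where they are used. *)
Definition complement (G : zmodType) (A B : set G) : Prop :=
  sumset A B = [set: G].

Definition minimal_complement (G : zmodType) (A B : set G) : Prop :=
  complement A B /\ forall a, A a -> ~ complement (A `\ a) B.

(* Main.v *)
(* Let S be a non-empty finite subset of an infinite abelian group G.  Pick points g_s
   (s in S) so far apart that g_s - g_t is never of the form (u - u') - (v - v')
   with u, u', v, v' in S, for s <> t, and let W be the complement of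
   B = {g_s - t | s <> t in S}.  Then g_s is not in (S \ s) + W.  If some x were
   not in S + W, then x - S would lie in B; the points being far apart, it would
   lie in {g_s - t | t in S \ s} for a single s, which has fewer elements
   than S. *)
Require Import Defs.
From mathcomp Require Import all_boot all_order all_algebra.
From mathcomp Require Import boolp classical_sets functions cardinality.
From mathcomp Require Import freeg.

Import GRing.Theory.
Local Open Scope classical_set_scope.

Lemma infinite_set_notin_seq (T : eqType) (s : seq T) :
  infinite_set [set: T] -> exists x, x \notin s.
Proof.
move=> Tinf; apply: contrapT => sT; apply: Tinf.
apply/finite_seqP; exists s; apply/seteqP; split=> x //= _.
by apply: contrapT => /negP xs; apply: sT; exists x.
Qed.

(** Greedy choice along [s]: the value at a new index only has to avoid the finitely many elements
    of [g t + F] and [g t - F] with [t] in [s]. Both signs occur because [F] need not be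
    symmetric. *)
Lemma exists_separated (G : zmodType) (F s : seq G) :
  infinite_set [set: G] ->
  exists g : G -> G, {in s &, forall a b, a != b -> (g a - g b)%R \notin F}.
Proof.
move=> Ginf; elim: s => [|c s [g gP]]; first by exists id.
have [y] := infinite_set_notin_seq _
  ([seq (g t + f)%R | t <- s, f <- F] ++ [seq (g t - f)%R | t <- s, f <- F])
  Ginf.
rewrite mem_cat negb_or => /andP[yD yB].
exists (fun a => if a == c then y else g a) => a b; rewrite !inE.
have [->|_] := eqVneq a c; have [->|_] := eqVneq b c => //=.
- move=> _ bs _; apply: contra yD => bF; apply/allpairsP.
  by exists (b, (y - g b)%R); split=> //=; rewrite addrC subrK.
- move=> as_ _ _; apply: contra yB => aF; apply/allpairsP.
  by exists (a, (g a - y)%R); split=> //=; rewrite opprB addrC subrK.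
- exact: gP.
Qed.

(** An injective map of a finite set into itself is a permutation, so the inverse translation
    preserves [s] too. *)
Lemma uniq_shift_surj (G : zmodType) (s : seq G) (c : G) : uniq s ->
  {in s, forall u, (u - c)%R \in s} -> {in s, forall v, (v + c)%R \in s}.
Proof.
move=> s_uniq sc v vs.
have cs_uniq : uniq [seq (u - c)%R | u <- s].
  by rewrite map_inj_uniq //; apply: addIr.
have cs_sub : {subset [seq (u - c)%R | u <- s] <= s}.
  by move=> _ /mapP[u us ->]; apply: sc.
have [|_ cs_eq] := uniq_min_size cs_uniq cs_sub; first by rewrite size_map.
by move: vs; rewrite -cs_eq => /mapP[u us ->]; rewrite subrK.
Qed.

Lemma infinite_minimal_complement (G : zmodType) (S : set G) :
  infinite_set [set: G] -> finite_set S -> S !=set0 ->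
  exists W, minimal_complement S W.
Proof.
move=> Ginf /finite_seqP[s0 ->] [u0 Su0]; set s := undup s0.
have s_uniq : uniq s by rewrite undup_uniq.
have memS x : (x \in s0) = (x \in s) by rewrite /s mem_undup.
pose D := [seq (u - t)%R | u <- s, t <- s].
have [g gP] := exists_separated G [seq (d - e)%R | d <- D, e <- D] s Ginf.
pose B := [set x | exists a t, [/\ a \in s, t \in s, a != t & x = (g a - t)%R]].
exists (~` B); split; last first.
  move=> a /=; rewrite memS => sa cmpl.
  have [t [/=]] : sumset ([set` s0] `\ a) (~` B) (g a) by rewrite cmpl.
  rewrite memS => ts ta [w Bw gaE]; apply: Bw; exists a, t; split=> //.
    by apply/eqP => /esym.
  by rewrite -gaE addrAC subrr add0r.
apply/seteqP; split=> // x _; apply: contrapT => xSW.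
have xB u : u \in s -> B (x - u)%R.
  move=> us; apply: contrapT => xuB; apply: xSW; exists u; first by rewrite /= memS.
  by exists (x - u)%R => //; rewrite addrC subrK.
have xg a u t : (x - u = g a - t -> x - g a = u - t)%R.
  by move=> e; rewrite -[x](subrK u) e addrAC [(g a - t)%R]addrC addrK addrC.
have u0s : u0 \in s by rewrite -memS.
have [a [t0 [as_ t0s _ xt0]]] := xB u0 u0s.
have xa u : u \in s -> exists t, [/\ t \in s, a != t & x - g a = u - t]%R.
  move=> us; have [b [t [bs ts bt xt]]] := xB u us.
  (* If [a] and [b] differed, then [g a - g b = (x - g b) - (x - g a) = (u - t) - (u0 - t0)] would
     be a forbidden difference. *)
  suff -> : a = b by exists t; split=> //; apply: xg.
  apply: contrapT => /eqP /(gP _ _ as_ bs) /negP; apply.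
  apply/allpairsP; exists (u - t, u0 - t0)%R; split=> /=.
  - by apply/allpairsP; exists (u, t).
  - by apply/allpairsP; exists (u0, t0).
  - by rewrite -(xg _ _ _ xt) -(xg _ _ _ xt0) opprB [RHS]addrC addrA subrK.
(* Translation by [x - g a] thus permutes [s], so some [u] in [s] is the translate of [a]. Its
   partner [t] can only be [a], which [a != t] excludes. *)
have xas : {in s, forall u, (u - (x - g a))%R \in s}.
  by move=> u /xa[t [ts _ ->]]; rewrite subKr.
have [t [_ /eqP at_]] := xa _ (uniq_shift_surj _ _ _ s_uniq xas a as_).
rewrite addrAC => e; apply: at_; apply: subr0_eq.
by apply: (addIr (x - g a)%R); rewrite add0r -e.
Qed.

(** A nonzero element has a nonzero integer coefficient, which tells its multiples apart. *)
Lemma free_abelian_infinite (G : zmodType) :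
  free_abelian G -> (exists x : G, x != 0%R) -> infinite_set [set: G].
Proof.
move=> [K [f [f' fK f'K]]] [x x0].
have [k xk] : exists k, coeff k (f' x) != 0%R.
  apply: contrapT => noK; move/eqP: x0; apply.
  rewrite -[x]f'K -(raddf0 f); congr (f _); apply/eqP/freeg_eqP => k.
  by rewrite coeff0; apply: contrapT => /eqP xk; apply: noK; exists k.
have xinj : injective (fun n => x *+ n)%R.
  move=> m n /=; rewrite -[x]f'K -!raddfMn => /(can_inj fK) /(congr1 (coeff k)).
  by rewrite !coeffMn; apply: Num.Theory.mulrIn.
move=> Gfin; apply: infinite_nat.
rewrite -(preimage_setT (fun n => x *+ n)%R).
by apply: finite_preimage => // ? ? _ _; apply: xinj.
Qed.

Theorem theoremA (G : zmodType) (hG : free_abelian G)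
    (S : set G) (S_fin : finite_set S) (S_neq0 : S !=set0) :
  exists W : set G, W !=set0 /\ minimal_complement S W.
Proof.
suff [W SW] : exists W, minimal_complement S W.
  exists W; split=> //; have [SW_T _] := SW.
  have : sumset S W 0%R by rewrite SW_T.
  by move=> [_ _ [w Ww _]]; exists w.
have [[x x0]|G0] := pselect (exists x : G, x != 0%R).
  apply: infinite_minimal_complement => //.
  by apply: free_abelian_infinite => //; exists x.
(* Rank zero: [G] is a single point, so [S] minus its point is empty and [W = G] works. *)
have G1 (x y : G) : x = y.
  have z0 (z : G) : z = 0%R.
    by apply: contrapT => /eqP z0; apply: G0; exists z.
  by rewrite (z0 x) (z0 y).
have [s Ss] := S_neq0; exists setT; split.
  by apply/seteqP; split=> // x _; exists s => //; exists 0%R.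
move=> a Sa cmpl.
have [t [_ /= ta] _] : sumset (S `\ a) setT 0%R by rewrite cmpl.
by apply: ta; apply: G1.
Qed.
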